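(* Every even integer $n > 3$ can be written as $n = p + \eta$, where $p$ is a prime and $\eta$ is an odd square-free number.
   Context: A square-free number is a positive integer not divisible by the square of any prime; in particular $1$ is square-free. *)

(* Defs.v *)
From mathcomp Require Import all_boot.

Set Implicit Arguments.
Unset Strict Implicit.
Unset Printing Implicit Defensive.

Definition square_free (m : nat) : Prop :=
  0 < m /\ forall q : nat, prime q -> ~~ (q ^ 2 %| m).

(* Main.v *)
(* Suppose n is even and n - p is not square-free for every prime p with
   n / 18 + 1 < p < n.  Each such p lies, for some odd prime q, in the class
   p = n + q^2 mod 2 q^2, so the product of all these primes is at most the
   product over q of the primes in one progression of difference 2 q^2.  With
   M ~ n / (2 q^2) terms, the latter is bounded in the style of Chebyshev: the
   product of the terms is divisible both by the primes and by the part of M!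
   prime to 2 q, which gives a bound (4 q^2 q^(1/(q-1)))^M (if q divides n, the only
   possible p is q itself).  Written as powers of 2, these bounds have exponents
   that add up to less than 0.83 n, whereas the central binomial coefficient and
   the bound 4^k for the primorial give at least (8/9) n for the product of
   the primes themselves.  The error terms are O(sqrt n log n), which settles
   n >= 2^16; the smaller n are checked by computation. *)
Require Import Defs.
From Stdlib Require Import PArith NArith MSetPositive.
From mathcomp Require Import all_boot all_order all_algebra zify ring lra.

Set Implicit Arguments.
Unset Strict Implicit.
Unset Printing Implicit Defensive.

(** * Primes and central binomial coefficients *)

Lemma mul_central_binS m :
  m.+1 * 'C(m.+1.*2, m.+1) = 2 * m.*2.+1 * 'C(m.*2, m).
Proof.
have e1 := mul_bin_diag m.+1.*2 m; have e2 := mul_bin_down m.*2.+1 m.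
have {e2}e2 : m.*2.+1 * 'C(m.*2, m) = m.+1 * 'C(m.*2.+1, m).
  by rewrite e2; congr (_ * _); lia.
rewrite -e1 -mulnA e2 doubleS /=; lia.
Qed.

Lemma expn4_leq_central_bin m : 0 < m -> 4 ^ m <= m.*2 * 'C(m.*2, m).
Proof.
case: m => // m _; elim: m => [//|m IHm].
have := mul_central_binS m.+1; rewrite expnS; set C2 := 'C(m.+2.*2, m.+2) => e.
apply: (@leq_trans (2 * (m.+2 * C2))); last by lia.
by rewrite e; nia.
Qed.

Lemma central_bin_leq m : 'C(m.+1.*2, m.+1) <= 2 * 4 ^ m.
Proof.
elim: m => [//|m IHm]; have := mul_central_binS m.+1; rewrite expnS.
set C2 := 'C(m.+2.*2, m.+2) => e.
by rewrite -(leq_pmul2l (ltn0Sn m.+1)) e; nia.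
Qed.

Lemma bin_odd_leq m : 'C(m.*2.+1, m) <= 4 ^ m.
Proof.
have := central_bin_leq m; rewrite doubleS binS.
rewrite -(@bin_sub _ m.+1) ?subSS; last by lia.
have -> : m.*2 - m = m by lia.
by lia.
Qed.

(** Legendre's formula over a range depending on [n] only, so that the sums for several factorials
    can be compared term by term. *)
Lemma logn_fact_widen p m n : prime p -> m <= n ->
  logn p m`! = \sum_(1 <= k < n.+1) m %/ p ^ k.
Proof.
move=> p_pr le_mn; rewrite logn_fact // (big_cat_nat (n := m.+1) _ (p := n.+1)) //=.
rewrite [X in _ = _ + X]big_nat_cond [X in _ = _ + X]big1 ?addn0 // => k.
rewrite andbT => /andP[lt_mk _]; rewrite divn_small //.
by apply: (leq_trans lt_mk); apply/ltnW/ltn_expl/prime_gt1.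
Qed.

(** By Legendre's formula each [k] contributes to the exponent of [p] the carry [n %/ p ^ k - m %/ p
    ^ k - (n - m) %/ p ^ k], which is 0 or 1 and vanishes once [p ^ k > n]. *)
Lemma expn_logn_bin_leq p m n :
  prime p -> 0 < n -> m <= n -> p ^ logn p 'C(n, m) <= n.
Proof.
move=> p_pr n_gt0 le_mn; have p_gt1 := prime_gt1 p_pr.
apply: leq_trans (trunc_logP p_gt1 n_gt0); rewrite leq_exp2l //.
have C_gt0 : 0 < 'C(n, m) by rewrite bin_gt0.
have := congr1 (logn p) (bin_fact le_mn).
rewrite !lognM ?muln_gt0 ?fact_gt0 //.
rewrite (logn_fact_widen p_pr le_mn) (logn_fact_widen p_pr (leq_subr m n)).
rewrite (logn_fact_widen p_pr (leqnn n)) -big_split /= => e.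
rewrite -(leq_add2r (\sum_(1 <= k < n.+1) (m %/ p ^ k + (n - m) %/ p ^ k))) e.
have sum_le t : \sum_(1 <= k < n.+1) (k <= t) <= t.
  suff -> : \sum_(1 <= k < n.+1) (k <= t) = minn n t by exact: geq_minr.
  elim: n {n_gt0 le_mn C_gt0 e} => [|j IHj]; first by rewrite big_geq // min0n.
  by rewrite big_nat_recr //= IHj; lia.
apply: leq_trans (leq_add (sum_le _) (leqnn _)).
rewrite -big_split /=; rewrite big_nat_cond [leqRHS]big_nat_cond.
apply: leq_sum => k /andP[/andP[k_gt0 _] _].
have d_gt0 : 0 < p ^ k by rewrite expn_gt0 ltnW.
have [le_kt | lt_tk] := leqP k (trunc_log p n).
  rewrite -[in leqLHS](subnKC le_mn) divnD // addnC leq_add2r.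
  exact: leq_b1.
rewrite divn_small //; apply: leq_trans (trunc_log_ltn n p_gt1) _.
by rewrite leq_exp2l.
Qed.

Lemma coprime_prod (I : eqType) (r : seq I) (P : pred I) (F : I -> nat) a :
    {in r, forall i, P i -> coprime a (F i)} ->
  coprime a (\prod_(i <- r | P i) F i).
Proof.
move=> coF; rewrite big_seq_cond; elim/big_ind: _ => [|x y cx cy|i /andP[ri Pi]].
- exact: coprimen1.
- by rewrite coprimeMr cx.
- exact: coF.
Qed.

Lemma prod_primes_dvd (r : seq nat) (P : pred nat) N :
    uniq r -> {in r, forall p, P p -> prime p && (p %| N)} ->
  \prod_(p <- r | P p) p %| N.
Proof.
elim: r => [|p r IHr] /=; first by rewrite big_nil dvd1n.
case/andP=> pr Ur H; rewrite big_cons.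
have Hr : \prod_(p <- r | P p) p %| N.
  by apply: IHr => // x xr; apply: H; rewrite inE xr orbT.
case: ifP => // Pp; have /andP[p_pr pN] := H p (mem_head _ _) Pp.
rewrite Gauss_dvd ?pN // coprime_prod // => x xr Px.
have /andP[x_pr _] : prime x && (x %| N) by apply: H; rewrite // inE xr orbT.
by rewrite prime_coprime // dvdn_prime2 //; apply: contraNneq pr => ->.
Qed.

Lemma prime_ndvd_fact p k : prime p -> k < p -> ~~ (p %| k`!).
Proof.
move=> p_pr; elim: k => [|k IHk] lt_kp.
  by rewrite fact0 dvdn1 neq_ltn prime_gt1 ?orbT.
by rewrite factS Euclid_dvdM // negb_or IHk ?(ltnW lt_kp) // gtnNdvd.
Qed.

(** Erdos's induction: at an odd number [2m + 1], the primes above [m + 1] divide the binomial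
    coefficient of [2m + 1] over [m], which is at most [4 ^ m], and the primes up to [m + 1]
    contribute at most [4 ^ (m + 1)]. *)
Lemma primorial_leq n : \prod_(1 <= p < n.+1 | prime p) p <= 4 ^ n.
Proof.
elim/ltn_ind: n => -[|n] IHn; first by rewrite big_geq.
have [n_pr | n_npr] := boolP (prime n.+1); last first.
  rewrite big_mkcond big_nat_recr //= (negPf n_npr) muln1 -big_mkcond.
  by apply: leq_trans (IHn n _) _; rewrite // leq_exp2l.
have [n_odd | n_even] := boolP (odd n).
  have /eqP-> : n == 1 by case: (even_prime n_pr) => /=; rewrite ?n_odd //; lia.
  by rewrite /index_iota /= unlock.
set m := n./2; have nE : n = m.*2 by rewrite even_halfK.
have [m0 | m_gt0] := posnP m.
  by rewrite nE m0 /index_iota /= unlock.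
rewrite (big_cat_nat (n := m.+2)) //=; last by rewrite nE; lia.
rewrite {2}(_ : n.+1 = m.+1 + m) ?expnD; last by rewrite nE; lia.
apply: leq_mul; first by apply: IHn; rewrite nE; lia.
apply: leq_trans (bin_odd_leq m); apply: dvdn_leq; first by rewrite bin_gt0; lia.
apply: prod_primes_dvd => [|p]; first exact: iota_uniq.
rewrite mem_index_iota nE => /andP[lt_mp lt_pm] p_pr; rewrite p_pr /=.
have le_m : m <= m.*2.+1 by lia.
have : p %| (m.*2.+1)`! by rewrite dvdn_fact //; lia.
rewrite -(bin_fact le_m) !Euclid_dvdM //.
rewrite (negPf (prime_ndvd_fact p_pr _)); last by lia.
by rewrite (negPf (prime_ndvd_fact p_pr _)) ?orbF //; lia.
Qed.

(** Chebyshev's lower bound: [4 ^ m] is at most [2m] times the central binomial coefficient, whose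
    prime powers are at most [2m]; a prime [p > s] has [p ^ 2 > 2m], so it occurs at most once. *)
Lemma expn2_leq_prod_primes m s : 0 < m -> m.*2 < s.+1 ^ 2 ->
  2 ^ m.*2 <= m.*2 *
    \prod_(1 <= p < m.*2.+1 | prime p) (if p <= s then m.*2 else p).
Proof.
move=> m_gt0 lt_ns; rewrite -mul2n expnM mul2n.
apply: leq_trans (expn4_leq_central_bin m_gt0) _; rewrite leq_mul2l; apply/orP; right.
set n := m.*2 in lt_ns *; have n_gt0 : 0 < n by rewrite double_gt0.
have le_mn : m <= n by rewrite /n; lia.
have C_gt0 : 0 < 'C(n, m) by rewrite bin_gt0.
rewrite {1}(prod_prime_decomp C_gt0) prime_decompE big_map /=.
apply: (@leq_trans (\prod_(p <- primes 'C(n, m)) (if p <= s then n else p))).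
  rewrite big_seq [leqRHS]big_seq; apply: leq_prod => p.
  rewrite mem_primes => /andP[p_pr _].
  have le_pn := expn_logn_bin_leq p_pr n_gt0 le_mn; case: (leqP p s) => // lt_sp.
  apply: (@leq_trans (p ^ 1)) => //; rewrite leq_exp2l ?prime_gt1 //.
  rewrite -ltnS -(ltn_exp2l _ _ (prime_gt1 p_pr)).
  apply: leq_ltn_trans le_pn (leq_trans lt_ns _).
  by rewrite leq_sqr.
rewrite -[leqRHS]big_filter.
have sub : {subset primes 'C(n, m) <= [seq p <- index_iota 1 n.+1 | prime p]}.
  move=> p; rewrite mem_primes mem_filter mem_index_iota => /and3P[p_pr _ pC].
  rewrite p_pr prime_gt0 //= ltnS.
  apply: leq_trans (expn_logn_bin_leq p_pr n_gt0 le_mn).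
  apply: (@leq_trans (p ^ 1)) => //.
  by rewrite leq_exp2l ?prime_gt1 // logn_gt0 mem_primes p_pr C_gt0.
rewrite [leqRHS](bigID (mem (primes 'C(n, m)))) /= -[leqLHS]muln1.
apply: leq_mul.
  rewrite -[leqRHS]big_filter; set r := filter _ _.
  suff r_perm : perm_eq (primes 'C(n, m)) r by rewrite (perm_big _ r_perm).
  apply: uniq_perm; rewrite ?primes_uniq ?filter_uniq ?iota_uniq // => p.
  by rewrite mem_filter; case: (boolP (p \in primes _)) => //= /sub->.
rewrite big_seq_cond; elim/big_ind: _ => // [x y x_gt0 y_gt0|p].
  by rewrite muln_gt0 x_gt0.
by rewrite mem_filter => /andP[/andP[/prime_gt0 p_gt0 _] _]; case: ifP.
Qed.

(** * Primes in an arithmetic progression *)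

Lemma logn_fact_mul_leq p n : prime p -> logn p n`! * p.-1 <= n.
Proof.
move=> p_pr; have p_gt1 := prime_gt1 p_pr; rewrite logn_fact //.
(* The added term [n %/ p ^ j] carries the induction, since [p * (n %/ p ^ j.+1) <= n %/ p ^ j]. *)
suff le_n j : (\sum_(1 <= k < j.+1) n %/ p ^ k) * p.-1 + n %/ p ^ j <= n.
  exact: leq_trans (leq_addr _ _) (le_n n).
elim: j => [|j IHj]; first by rewrite big_geq // mul0n expn0 divn1.
rewrite big_nat_recr //= mulnDl.
have : n %/ p ^ j.+1 * p <= n %/ p ^ j.
  by rewrite expnSr divnMA leq_trunc_div.
by move: IHj; case: p p_pr p_gt1 => // p _ _ /=; nia.
Qed.

(* Multiplying by an inverse of [d] modulo [D] turns the progression into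
   [M] consecutive integers, whose product is divisible by [M`!]. *)
Lemma dvdn_prod_progression D M r d :
  coprime d D -> D %| M`! -> D %| \prod_(k < M) (r + d * k).
Proof.
move=> co_dD D_M.
have D_gt0 : 0 < D by apply: dvdn_gt0 D_M; exact: fact_gt0.
have [u ud1] : exists u, u * d = 1 %[mod D].
  have [d0 | d_gt0] := posnP d.
    by exists 0; move: co_dD; rewrite d0 /coprime gcd0n => /eqP->; rewrite !modn1.
  have [u v uE _] := egcdnP D d_gt0; exists u.
  by rewrite uE (eqP co_dD) modnMDl.
have co_uD : coprime D u.
  have : coprime D (u * d) by rewrite -coprime_modr ud1 coprime_modr coprimen1.
  by rewrite coprimeMr => /andP[].
rewrite -(Gauss_dvdr _ (coprimeXr M co_uD)).
have -> : u ^ M = \prod_(k < M) u by rewrite prod_nat_const card_ord.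
rewrite -big_split /=.
have consec a : M`! %| \prod_(k < M) (a + k).
  case: a => [|a].
    by case: M {D_M} => [|M]; rewrite ?big_ord0 // big_ord_recl mul0n.
  have -> : \prod_(k < M) (a.+1 + k) = (a + M) ^_ M.
    elim: M {D_M} => [|M IHM]; first by rewrite big_ord0 ffactn0.
    by rewrite big_ord_recr /= IHM addnS ffactnS /= mulnC; congr (_ * _); lia.
  by rewrite -bin_ffact dvdn_mull.
have := dvdn_trans D_M (consec (u * r)); rewrite /dvdn.
suff -> : \prod_(k < M) (u * (r + d * k)) = \prod_(k < M) (u * r + k) %[mod D] by [].
have term k : u * (r + d * k) = u * r + k %[mod D].
  by rewrite mulnDr mulnA -modnDmr -(modnMml (u * d)) ud1 modnMml mul1n modnDmr.
apply: (big_rec2 (fun x y => x = y %[mod D])) => // k x y _ xy.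
by rewrite -modnMm term xy modnMm.
Qed.

(* The part of [M`!] prime to [2 * q] divides the product of the progression
   and is coprime to the primes in question, as those exceed [M]. *)
Lemma prod_primes_progression_leq (q M r : nat) (s : seq nat) (P : pred nat) :
    prime q -> 0 < r <= 2 * q ^ 2 -> uniq s ->
    {in s, forall p, P p -> [/\ prime p, M < p &
      exists2 k, k < M & p = r + 2 * q ^ 2 * k]} ->
  \prod_(p <- s | P p) p <= (4 * q ^ 2) ^ M * q ^ logn q M`!.
Proof.
move=> q_pr /andP[r_gt0 le_r] Us sP; set d := 2 * q ^ 2 in le_r *.
have f_gt0 := fact_gt0 M.
pose D := M`!`_2^'`_q^'; pose A := \prod_(p <- s | P p) p.
pose Q := \prod_(k < M) (r + d * k).
have D_M : D %| M`! by apply: dvdn_trans (dvdn_part _ _) (dvdn_part _ _).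
have D_gt0 : 0 < D by rewrite part_gt0.
have DE : M`! = 2 ^ logn 2 M`! * (M`!`_2^'`_q * D).
  by rewrite -p_part !partnC // part_gt0.
have co_dD : coprime d D.
  rewrite coprimeMl coprime_pexpl //; apply/andP; split.
    apply: (@pnat_coprime 2); first exact: pnat_id.
    by apply: pnat_dvd (part_pnat _ M`!); exact: dvdn_part.
  by apply: (@pnat_coprime q); [exact: pnat_id | exact: part_pnat].
have Q_gt0 : 0 < Q by apply: prodn_gt0 => k; rewrite addn_gt0 r_gt0.
(* As [r <= d], the term [r + d * k] is at most [d * k.+1]. *)
have leQ : Q <= d ^ M * M`!.
  have -> : d ^ M * M`! = \prod_(k < M) (d * k.+1).
    rewrite big_split /= prod_nat_const card_ord fact_prod; congr (_ * _).
    by rewrite big_add1 /= big_mkord.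
  by apply: leq_prod => k _; rewrite mulnS leq_add2r.
have A_Q : A %| Q.
  apply: prod_primes_dvd => // p sp Pp.
  have [p_pr _ [k ltk pE]] := sP p sp Pp; rewrite p_pr pE /=.
  by rewrite /Q (bigD1 (Ordinal ltk)) //= dvdn_mulr.
have DA_Q : D * A %| Q.
  rewrite Gauss_dvd ?A_Q ?dvdn_prod_progression // coprime_prod // => p sp Pp.
  have [p_pr ltMp _] := sP p sp Pp.
  apply: coprime_dvdl D_M _.
  by rewrite coprime_sym prime_coprime // prime_ndvd_fact.
have : D * A <= d ^ M * M`! by apply: leq_trans leQ; apply: dvdn_leq.
(* The 2-part of the factorial costs at most [2 ^ M], which turns [(2 * q ^ 2) ^ M] into
   [(4 * q ^ 2) ^ M]. *)
have le2 : 2 ^ logn 2 M`! <= 2 ^ M.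
  by rewrite leq_exp2l //; have := logn_fact_mul_leq M (isT : prime 2); lia.
have leq' : M`!`_2^'`_q <= q ^ logn q M`!.
  rewrite p_part leq_exp2l ?prime_gt1 //; apply: dvdn_leq_log => //.
  exact: dvdn_part.
move=> leDA; rewrite -(leq_pmul2l D_gt0); apply: leq_trans leDA _.
have -> : (4 * q ^ 2) ^ M = d ^ M * 2 ^ M by rewrite -expnMn /d; congr (_ ^ _); lia.
have -> : d ^ M * M`! = D * d ^ M * (2 ^ logn 2 M`! * M`!`_2^'`_q).
  by rewrite [in LHS]DE [in RHS]mulnC -mulnA [D * _]mulnC !mulnA mulnAC; lia.
by rewrite -[d ^ M * _ * _]mulnA [leqRHS]mulnA; apply: leq_mul => //; apply: leq_mul.
Qed.

(* [2 ^ log_weight q] dominates [4 * q ^ 2 * q ^ (1 / (q - 1))]: by rounding up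
   for [q = 3], and because [q ^ (1 / (q - 1)) <= 3 / 2] for [q >= 5]. *)
Definition log_weight q := up_log 2 (6 * q ^ 2).

Lemma log_weight_root q : prime q -> odd q ->
  (4 * q ^ 2) ^ q.-1 * q <= 2 ^ (log_weight q * q.-1).
Proof.
move=> q_pr odd_q; have [q_lt5 | q_ge5] := ltnP q 5.
  have -> : q = 3 by have := odd_prime_gt2 odd_q q_pr; lia.
  have -> : log_weight 3 = 6 by apply: up_log_eq.
  suff: 1296 * 3 <= 64 ^ 2 by rewrite expnM.
  by vm_compute.
rewrite expnM; apply: (@leq_trans ((6 * q ^ 2) ^ q.-1)); last first.
  by rewrite leq_exp2r ?up_logP //; lia.
have -> : 4 * q ^ 2 = 2 * q ^ 2 * 2 by lia.
have -> : 6 * q ^ 2 = 2 * q ^ 2 * 3 by lia.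
(* What remains is [2 ^ (q - 1) * q <= 3 ^ (q - 1)], which starts with 80 <= 81 at [q = 5]. *)
rewrite ![(2 * _ * _) ^ _]expnMn -mulnA leq_mul2l; apply/orP; right.
have -> : q = (q - 5).+4.+1 by lia.
elim: (q - 5) => [|j IHj]; first by vm_compute.
by move: IHj; rewrite /= ![_ ^ j.+1.+4]expnS; lia.
Qed.

(** Raising both sides to the power [q.-1] avoids the fractional exponent [M / (q - 1)] that bounds
    the exponent of [q] in the factorial. *)
Lemma log_weight_fact q M : prime q -> odd q ->
  (4 * q ^ 2) ^ M * q ^ logn q M`! <= 2 ^ (log_weight q * M).
Proof.
move=> q_pr odd_q; have q1_gt0 : 0 < q.-1 by have := prime_gt1 q_pr; lia.
rewrite -(@leq_exp2r _ _ q.-1) // expnMn -!expnM.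
apply: (@leq_trans (((4 * q ^ 2) ^ q.-1 * q) ^ M)).
  rewrite [leqRHS]expnMn -[in leqRHS]expnM [q.-1 * M]mulnC leq_mul2l.
  by rewrite leq_exp2l ?prime_gt1 // logn_fact_mul_leq ?orbT.
rewrite (mulnAC _ M) expnM; case: M => // M.
by rewrite leq_exp2r ?log_weight_root.
Qed.

(** Here [n - p] is an odd multiple of [q ^ 2], and [uphalf (n %/ q ^ 2)] counts the odd multiples
    up to [n]. If [q] divides [n], then [q] divides [p], so [p = q]. *)
Lemma prod_primes_sqr_dvd_leq n q : ~~ odd n -> 18 <= n -> prime q -> odd q ->
    q ^ 2 <= n ->
  \prod_((n %/ 18).+2 <= p < n | prime p && (q ^ 2 %| n - p)) p <=
    2 ^ (log_weight q * uphalf (n %/ q ^ 2)).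
Proof.
move=> n_even n_ge q_pr odd_q le_q2n; set M := uphalf _.
have q_gt2 := odd_prime_gt2 odd_q q_pr.
have Q_ge9 : 9 <= q ^ 2 by rewrite (leq_sqr 3).
have Q_gt0 : 0 < q ^ 2 by lia.
have nE := divn_eq n (q ^ 2); have := ltn_pmod n Q_gt0.
have a_gt0 : 0 < n %/ q ^ 2 by rewrite divn_gt0 //; lia.
move: (n %/ q ^ 2) (n %% q ^ 2) => a b in M nE a_gt0 *; move=> lt_bQ.
have M_gt0 : 0 < M by rewrite /M; lia.
have [q_n | q_n] := boolP (q %| n).
  apply: (@leq_trans q); last first.
    apply: leq_trans (_ : 2 ^ log_weight q <= _); last by rewrite leq_exp2l //; nia.
    by apply: leq_trans (up_logP _ _) => //; nia.
  apply: dvdn_leq; first exact: prime_gt0.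
  apply: prod_primes_dvd => [|p]; first exact: iota_uniq.
  rewrite mem_index_iota => /andP[_ lt_pn] /andP[p_pr q2_np]; rewrite p_pr /=.
  suff : q %| p by rewrite dvdn_prime2 // => /eqP->.
  rewrite -(dvdn_addr p (_ : q %| n - p)) ?subnK ?(ltnW lt_pn) //.
  by apply: dvdn_trans q2_np; rewrite dvdn_exp.
(* A nonzero remainder makes the first term of the progression positive. *)
have b_gt0 : 0 < b.
  rewrite lt0n; apply: contraNneq q_n => b0.
  by rewrite nE b0 addn0 dvdn_mull ?dvdn_exp.
apply: leq_trans (log_weight_fact M q_pr odd_q).
(* [M.*2.-1] is the largest odd number not exceeding [n %/ q ^ 2]. *)
apply: (@prod_primes_progression_leq _ _ (n - q ^ 2 * M.*2.-1)) => //.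
- have := odd_double_half a; have : M = half a.+1 by [].
  rewrite {1}nE; case: (odd a) => /= ME aE.
    have -> : M.*2.-1 = a by lia.
    by rewrite nE mulnC addKn; lia.
  have -> : M.*2.-1 = a.-1 by lia.
  have -> : n = q ^ 2 * a.-1 + (q ^ 2 + b) by rewrite nE -{1}(prednK a_gt0) mulSn; lia.
  by rewrite addKn; lia.
- exact: iota_uniq.
move=> p; rewrite mem_index_iota => /andP[lt_p lt_pn] /andP[p_pr q2_np].
split=> //.
  (* The cutoff at [n %/ 18] serves here: [q ^ 2 >= 9] gives [M <= (n %/ 9 + 1) / 2 < p]. *)
  have : a <= n %/ 9 by rewrite leq_divRL //; nia.
  by rewrite /M; lia.
have p_odd : odd p by case: (even_prime p_pr) => // p2; lia.
have [e npE] := dvdnP q2_np.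
have e_odd : odd e.
  have : odd (n - p) by rewrite oddB ?(ltnW lt_pn) // p_odd (negPf n_even).
  by rewrite npE oddM => /andP[].
have le_ea : e <= a.
  by rewrite -ltnS -(ltn_pmul2r Q_gt0) -npE mulSn; lia.
have eE := odd_double_half e; rewrite e_odd in eE.
(* The progression ascends in [p], so the odd multiples are met in decreasing order. *)
exists (M.-1 - e./2); first by rewrite /M; lia.
have ME : M = (M.-1 - e./2) + e./2 + 1 by rewrite /M; lia.
move: (M.-1 - e./2) ME => k ME.
have -> : M.*2.-1 = k.*2 + e by lia.
have : q ^ 2 * M.*2.-1 <= n.
  have : M.*2.-1 <= a by rewrite /M; lia.
  by rewrite -(leq_pmul2l Q_gt0) nE; lia.
have -> : M.*2.-1 = k.*2 + e by lia.
have -> : q ^ 2 * (k.*2 + e) = 2 * q ^ 2 * k + e * q ^ 2 by lia.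
by lia.
Qed.

(** * The product of the primes against the sieve *)

Lemma prod_const_primes_leq x j : 0 < x ->
  \prod_(1 <= p < j.+2.*2 | prime p) x <= x ^ j.+2.
Proof.
(* The primes below 4 are 2 and 3; each further pair [2i, 2i + 1] adds at most one. *)
move=> x_gt0; elim: j => [|j IHj].
  by rewrite /index_iota /= unlock /= muln1.
have npr : prime j.+2.*2 = false.
  by apply/negP => /even_prime[|]; [lia | rewrite odd_double].
have a_gt0 : 0 < j.+2.*2 by [].
rewrite doubleS expnSr; move: j.+2.*2 npr a_gt0 IHj => a npr a_gt0 IHj.
rewrite big_mkcond !big_nat_recr //= npr muln1 -(big_mkcond prime (fun=> x)).
by apply: leq_mul IHj _; case: ifP.
Qed.

(** After the products are exchanged, [p] occurs once for each [q] with [q ^ 2] dividing [n - p];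
    such a [q] exists by hypothesis, and [q <= s] because [q ^ 2 <= n < s.+1 ^ 2]. *)
Lemma prod_primes_leq_sieve n s a :
    0 < a -> n < s.+1 ^ 2 ->
    (forall p, a <= p < n -> prime p ->
      exists q, [/\ prime q, odd q & q ^ 2 %| n - p]) ->
  \prod_(a <= p < n | prime p) p <=
    \prod_(3 <= q < s.+1 | prime q)
      \prod_(a <= p < n | prime p && (q ^ 2 %| n - p)) p.
Proof.
move=> a_gt0 lt_ns sieve.
have prod_gt0 r (P : pred nat) p : 0 < p -> 0 < \prod_(q <- r | P q) p.
  by move=> p_gt0; elim/big_ind: _ => // x y x_gt0 y_gt0; rewrite muln_gt0 x_gt0.
rewrite (exchange_big_dep prime) //=; last by move=> q p _ /andP[].
rewrite big_nat_cond [leqRHS]big_nat_cond.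
apply: leq_prod => p /andP[/andP[le_ap lt_pn] p_pr].
have [||q [q_pr odd_q q2_np]] := sieve p; rewrite ?le_ap //.
have p_gt0 := prime_gt0 p_pr.
have q_gt2 := odd_prime_gt2 odd_q q_pr.
have lt_qs : q < s.+1.
  rewrite -ltn_sqr; apply: leq_ltn_trans lt_ns.
  by apply: leq_trans (leq_subr p n); apply: dvdn_leq; rewrite // subn_gt0.
rewrite (big_rem q (F := fun=> p)) /=; last by rewrite mem_index_iota q_gt2.
by rewrite q_pr p_pr q2_np leq_pmulr // prod_gt0.
Qed.

(** Chebyshev's bound in base 2 logarithms. One factor [n] and at most [s./2 + 1] primes up to [s]
    give the first term, the primorial up to [(n %/ 18).+1] gives the second, and the sieved primes
    give the third. *)
Lemma sieve_exponent_bound n s t :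
    ~~ odd n -> 36 <= n -> 3 <= s -> s ^ 2 <= n -> n < s.+1 ^ 2 -> n <= 2 ^ t ->
    (forall p, (n %/ 18).+2 <= p < n -> prime p ->
      exists q, [/\ prime q, odd q & q ^ 2 %| n - p]) ->
  n <= t * (s./2 + 2) + 2 * (n %/ 18).+1 +
       \sum_(3 <= q < s.+1 | prime q) log_weight q * uphalf (n %/ q ^ 2).
Proof.
move=> n_even n_ge s_ge le_sn lt_ns le_nt sieve; set E := \sum_(_ <= _ < _ | _) _.
rewrite -(@leq_exp2l 2) // !expnD.
have nE : n = n./2.*2 by lia.
have n_gt0 : 0 < n by lia.
have n_npr : prime n = false.
  by apply/negP => /even_prime[|]; [lia | rewrite (negPf n_even)].
have n2_gt0 : 0 < n./2 by lia.
have /(expn2_leq_prod_primes n2_gt0) : n./2.*2 < s.+1 ^ 2 by rewrite -nE.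
rewrite -nE big_mkcond big_nat_recr //= n_npr muln1 -big_mkcond /=.
have lt_sn : s < n by nia.
have leF : \prod_(1 <= p < n | prime p) (if p <= s then n else p) <=
    n ^ (s./2).+1 * \prod_(1 <= p < n | prime p) p.
  apply: leq_trans (_ : _ <= \prod_(1 <= p < n | prime p)
                         ((if p <= s then n else 1) * p)) _.
    apply: leq_prod => p /prime_gt0 p_gt0.
    by case: ifP; rewrite ?mul1n ?leq_pmulr.
  rewrite big_split leq_mul2r; apply/orP; right.
  rewrite (big_cat_nat (n := s.+1)) //= [X in _ * X]big_nat_cond.
  rewrite [X in _ * X]big1 ?muln1; last by move=> p; case: ltnP.
  apply: leq_trans (_ : \prod_(1 <= p < s.+1 | prime p) n <= _).
    rewrite big_nat_cond [leqRHS]big_nat_cond.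
    by apply: leq_prod => p /andP[/andP[_ lt_ps] _]; case: ifP.
  have := prod_const_primes_leq (s./2 - 1) n_gt0.
  have -> : (s./2 - 1).+2 = (s./2).+1 by lia.
  apply: leq_trans; rewrite (big_cat_nat (n := s.+1) (p := (s./2).+1.*2)) //=; last by lia.
  rewrite leq_pmulr //; elim/big_ind: _ => // x y x_gt0 y_gt0.
  by rewrite muln_gt0 x_gt0.
move=> /leq_trans; apply.
have -> : t * (s./2 + 2) = t + t * (s./2).+1 by lia.
rewrite expnD -!mulnA; apply: leq_mul => //.
apply: leq_trans leF _; apply: leq_mul.
  by rewrite expnM; rewrite leq_exp2r.
rewrite (big_cat_nat (n := (n %/ 18).+2)) //=; last by lia.
rewrite expnM; apply: leq_mul; first exact: primorial_leq.
apply: leq_trans (prod_primes_leq_sieve _ lt_ns sieve) _ => //.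
rewrite expn_sum big_nat_cond [leqRHS]big_nat_cond.
apply: leq_prod => q /andP[/andP[q_gt2 lt_qs] q_pr].
apply: prod_primes_sqr_dvd_leq => //; first by lia.
  by case: (even_prime q_pr) => // q2; rewrite q2 in q_gt2.
by apply: leq_trans le_sn; rewrite leq_sqr.
Qed.

(** * Numerical estimates *)

Lemma log_weight_dyadic q m : q <= 2 ^ m -> log_weight q <= m.*2.+3.
Proof.
move=> le_q; apply: up_log_min => //.
have : q ^ 2 <= (2 ^ m) ^ 2 by rewrite leq_sqr.
by rewrite -expnM muln2 -(addn3 m.*2) expnD; lia.
Qed.

Lemma log_weight_leq q n t : q ^ 2 <= n -> n <= 2 ^ t -> log_weight q <= t + 3.
Proof.
move=> le_qn le_nt; apply: up_log_min => //; rewrite expnD.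
by apply: leq_trans (_ : 6 * 2 ^ t <= _); lia.
Qed.

(** Equality holds at [t = 0], where [15 * 17 + 1 = 256]; from then on the left side less than
    doubles at each step. *)
Lemma sqr_leq_expn2 t : (15 * (t + 17)).+1 ^ 2 <= 2 ^ (t + 16).
Proof.
elim: t => [|t IHt].
  by rewrite -[256]/(2 ^ 8) -expnM.
rewrite !addSn; apply: leq_trans (_ : 2 * (15 * (t + 17)).+1 ^ 2 <= _).
  by rewrite -!mulnn; nia.
by rewrite [leqRHS]expnS leq_mul.
Qed.

Lemma sqrt_ge_256 n s : 2 ^ 16 <= n -> n < s.+1 ^ 2 -> 256 <= s.
Proof.
move=> n_ge lt_ns; rewrite -ltnS -ltn_sqr; apply: leq_ltn_trans lt_ns.
by apply: leq_trans n_ge; rewrite -[256]/(2 ^ 8) -expnM.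
Qed.

(** This makes error terms of order [s * up_log 2 n] a small fraction of [s ^ 2]. *)
Lemma up_log2_leq n s : 2 ^ 16 <= n -> n < s.+1 ^ 2 -> 15 * up_log 2 n <= s.
Proof.
move=> n_ge lt_ns.
have s_ge := sqrt_ge_256 n_ge lt_ns.
have [le_t | lt_t] := leqP (up_log 2 n) 17; first by lia.
have n_gt1 : 1 < n by apply: leq_trans n_ge; rewrite -[1]/(2 ^ 0) ltn_exp2l.
have := up_log_gtn (isT : 1 < 2) n_gt1.
move: (up_log 2 n) lt_t => t lt_t lt_tn.
have := sqr_leq_expn2 (t - 17).
have -> : t - 17 + 17 = t by lia.
have -> : t - 17 + 16 = t.-1 by lia.
move=> /leq_ltn_trans/(_ lt_tn) /ltn_trans/(_ lt_ns).
by rewrite ltn_sqr ltnS; lia.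
Qed.

Section RationalBounds.

Import Order.TTheory GRing.Theory Num.Theory.
Local Open Scope ring_scope.

Lemma sum_odd_index (F : nat -> rat) a b : (a <= b)%N ->
  \sum_(a.*2 <= q < b.*2 | odd q) F q = \sum_(a <= i < b) F i.*2.+1.
Proof.
elim: b => [|b IHb] le_ab; first by rewrite !big_geq //; lia.
have [-> | ltab] := eqVneq a b.+1; first by rewrite !big_geq.
rewrite doubleS big_mkcond !big_nat_recr /=; try lia.
rewrite -big_mkcond IHb; last by lia.
by rewrite odd_double /= addr0.
Qed.

(* For [2 ^ m <= i < 2 ^ m.+1] the weight of [i.*2.+1] is at most [2 * m + 7] and
   [1 / (2 * i + 1) ^ 2] is less than [(1 / i - 1 / i.+1) / 4]; the second term
   of [tail_bound] pays for the increase of [m] in the later dyadic blocks. *)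
Definition tail_bound (i : nat) : rat :=
  ((trunc_log 2 i).*2 + 7)%:R / (4 * i%:R) + (2 * (2 ^ trunc_log 2 i)%:R)^-1.

Lemma tail_bound_step i : (0 < i)%N ->
  (log_weight i.*2.+1)%:R / ((i.*2.+1) ^ 2)%:R <= tail_bound i - tail_bound i.+1.
Proof.
rewrite /tail_bound => i_gt0.
have /andP[le_mi lt_im] := trunc_log_bounds (isT : (1 < 2)%N) i_gt0.
move: (trunc_log 2 i) le_mi lt_im => m le_mi lt_im.
(* [i < 2 ^ m.+1] gives [i.*2.+1 < 2 ^ m.+2], of weight at most [2 * (m + 2) + 3]. *)
have c_le : (log_weight i.*2.+1 <= m.*2 + 7)%N.
  apply: leq_trans (_ : m.+2.*2.+3 <= _)%N; last by lia.
  by apply: log_weight_dyadic; rewrite expnS; lia.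
have i_pos : 0 < i%:R :> rat by rewrite ltr0n.
(* If [i.+1 = 2 ^ m.+1], the new logarithm adds [2 / (4 * 2 ^ m.+1)] to the first term and takes
   exactly as much from the second, so [m] may be kept. *)
have -> : ((trunc_log 2 i.+1).*2 + 7)%:R / (4 * i.+1%:R) +
    (2 * (2 ^ trunc_log 2 i.+1)%:R)^-1 =
    (m.*2 + 7)%:R / (4 * i.+1%:R) + (2 * (2 ^ m)%:R)^-1 :> rat.
  have [lt_i1m | ] := ltnP i.+1 (2 ^ m.+1).
    by rewrite (@trunc_log_eq 2 m) // lt_i1m andbT; lia.
  rewrite leq_eqVlt ltnNge lt_im orbF => /eqP i1E.
  rewrite -i1E trunc_expnK // expnS !natrM.
  have pos : 0 < (2 ^ m)%:R :> rat by rewrite ltr0n expn_gt0.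
  rewrite doubleS !natrD -[_.+2]addn2 natrD.
  by field; rewrite gt_eqF.
rewrite [X in _ <= X](_ : _ = (m.*2 + 7)%:R / (4 * (i%:R * i.+1%:R))); last first.
  by rewrite -[i.+1%:R]natr1; field; rewrite natr1 !pnatr_eq0 -!lt0n i_gt0 expn_gt0.
have pos1 : 0 < (4 * (i%:R * i.+1%:R)) :> rat by rewrite !mulr_gt0 ?ltr0n.
have pos2 : 0 < (i.*2.+1 ^ 2)%:R :> rat by rewrite ltr0n; lia.
rewrite ler_pdivlMr // mulrAC ler_pdivrMr // -!natrM ler_nat.
by apply: leq_mul c_le _; nia.
Qed.

Lemma sum_tail_bound a b : (0 < a <= b)%N ->
  \sum_(a <= i < b) (log_weight i.*2.+1)%:R / ((i.*2.+1) ^ 2)%:R <= tail_bound a.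
Proof.
move=> /andP[a_gt0 le_ab].
apply: (@le_trans _ _ (tail_bound a - tail_bound b)); last first.
  by rewrite lerBlDr lerDl /tail_bound addr_ge0 ?mulr_ge0 ?invr_ge0 ?mulr_ge0 ?ler0n //.
rewrite -[leRHS]opprB -[tail_bound b - _](telescope_sumr _ le_ab) -sumrN.
rewrite big_nat_cond [leRHS]big_nat_cond; apply: ler_sum => i /andP[/andP[le_ai _] _].
by rewrite opprB tail_bound_step // (leq_trans a_gt0).
Qed.

(** Rounding up to multiples of [1 / K] reduces a sum of fractions to a computation in [nat]. *)
Lemma divr_leq_ceil (K a b : nat) : (0 < K)%N -> (0 < b)%N ->
  a%:R / b%:R <= ((K * a) %/ b).+1%:R / K%:R :> rat.
Proof.
move=> K_gt0 b_gt0; rewrite ler_pdivrMr ?ltr0n // mulrAC ler_pdivlMr ?ltr0n //.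
by rewrite -!natrM ler_nat mulnC ltnW // ltn_ceil.
Qed.

Lemma sum_small_bound :
  \sum_(3 <= q < 64 | prime q) (log_weight q)%:R / (q ^ 2)%:R <= 373 / 250 :> rat.
Proof.
pose w K q := ((K * log_weight q) %/ q ^ 2).+1.
(* Terms are rounded up to thousandths, and 1492 / 1000 = 373 / 250. *)
have w_le : (\sum_(3 <= q < 64 | prime q) w 1000 q <= 1492)%N.
  by rewrite -big_filter -(big_map (w 1000) predT id) -sumnE; vm_compute.
have sum_le K B : (0 < K)%N -> (\sum_(3 <= q < 64 | prime q) w K q <= B)%N ->
    \sum_(3 <= q < 64 | prime q) (log_weight q)%:R / (q ^ 2)%:R <=
    B%:R / K%:R :> rat.
  move=> K_gt0 le_B; have K_pos : 0 < K%:R :> rat by rewrite ltr0n.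
  rewrite ler_pdivlMr //; apply: le_trans (_ : (\sum_(3 <= q < 64 | prime q) w K q)%:R <= _).
    rewrite natr_sum mulr_suml; apply: ler_sum => q q_pr.
    by rewrite -ler_pdivlMr // divr_leq_ceil // expn_gt0 prime_gt0.
  by rewrite ler_nat.
by have := sum_le 1000 1492 isT w_le; lra.
Qed.

Lemma sum_primes_leq_odd (F : nat -> rat) a s :
    (1 < a)%N -> (a.*2 <= s.+1)%N -> (forall q, 0 <= F q) ->
  \sum_(a.*2 <= q < s.+1 | prime q) F q <= \sum_(a <= i < s./2.+1) F i.*2.+1.
Proof.
move=> a_gt1 le_as F_ge0; rewrite -sum_odd_index; last by lia.
rewrite [leRHS](big_cat_nat (n := s.+1)) //=; last by lia.
rewrite -[leLHS]addr0 lerD ?sumr_ge0 //.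
rewrite big_nat_cond [leRHS]big_nat_cond big_mkcond [leRHS]big_mkcond.
apply: ler_sum => q _; have [/andP[/andP[le_aq lt_qs] q_pr] | _] := ifP; last by case: ifP.
rewrite le_aq lt_qs /=; case: (even_prime q_pr) => [q2 | -> //].
by rewrite q2 in le_aq; lia.
Qed.

Lemma half_mul_leq (x y z : rat) :
  0 <= x -> y * 2 <= z -> x / 2 * y <= x * z / 4.
Proof.
move=> x_ge0 le_yz; have le_xyz : x * (y * 2) <= x * z by rewrite ler_wpM2l.
by lra.
Qed.

(** Since [uphalf a <= (a + 1) / 2], the main term is [n / 2] times the sum of
    [log_weight q / q ^ 2]: at most [373 / 250] for [q < 64] and [tail_bound 32 = 19 / 128] beyond.
    The added halves have weight at most [t + 3] and fall on at most [s / 2] odd primes. *)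
Lemma sum_log_weight_leq n s t :
  (2 ^ 16 <= n)%N -> (s ^ 2 <= n)%N -> (n < s.+1 ^ 2)%N -> (n <= 2 ^ t)%N ->
  (\sum_(3 <= q < s.+1 | prime q) log_weight q * uphalf (n %/ q ^ 2))%:R <=
   n%:R / 2 * (373 / 250 + 19 / 128) + (t + 3)%:R * s%:R / 4 :> rat.
Proof.
move=> n_ge le_sn lt_ns le_nt.
have s_ge := sqrt_ge_256 n_ge lt_ns.
rewrite natr_sum.
pose F q : rat := (log_weight q)%:R / (q ^ 2)%:R.
have F_ge0 q : 0 <= F q by rewrite divr_ge0.
apply: (@le_trans _ _ (\sum_(3 <= q < s.+1 | prime q)
          (n%:R / 2 * F q + (t + 3)%:R / 2))).
  rewrite big_nat_cond [leRHS]big_nat_cond.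
  apply: ler_sum => q /andP[/andP[q_gt2 lt_qs] q_pr].
  have le_q2n : (q ^ 2 <= n)%N by apply: leq_trans le_sn; rewrite leq_sqr.
  have q2_gt0 : 0 < (q ^ 2)%:R :> rat by rewrite ltr0n expn_gt0 prime_gt0.
  have : (log_weight q)%:R <= (t + 3)%:R :> rat.
    by rewrite ler_nat; apply: log_weight_leq le_nt.
  have : (uphalf (n %/ q ^ 2))%:R <= (n%:R / (q ^ 2)%:R + 1) / 2 :> rat.
    rewrite ler_pdivlMr // -lerBlDr ler_pdivlMr //.
    rewrite mulrBl mul1r lerBlDr -!natrM -natrD ler_nat.
    have := leq_trunc_div n (q ^ 2); move: (n %/ q ^ 2)%N => a le_aQ.
    have : (uphalf a * 2 <= a.+1)%N by lia.
    by move=> /(leq_mul)/(_ (leqnn (q ^ 2))); rewrite mulSn; lia.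
  have c_ge0 : 0 <= (log_weight q)%:R :> rat by [].
  rewrite natrM => /(ler_wpM2l c_ge0) leM le_c; apply: le_trans leM _.
  by rewrite /F; lra.
rewrite big_split /= -mulr_sumr.
have F_le : \sum_(3 <= q < s.+1 | prime q) F q <= 373 / 250 + 19 / 128.
  rewrite (big_cat_nat (n := 64)) /=; [|by []|by lia].
  apply: lerD; first exact: sum_small_bound.
  have lt_s : (32 < s./2.+1)%N by lia.
  apply: le_trans (@sum_primes_leq_odd F 32 s _ _ F_ge0) _; [by []|by lia|].
  apply: le_trans (sum_tail_bound _) _; first by rewrite (ltnW lt_s).
  have -> : tail_bound 32 = 17%:R / (4 * 32%:R) + (2 * 32%:R)^-1.
    by rewrite /tail_bound (_ : trunc_log 2 32 = 5)%N.
  by lra.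
have n2_ge0 : 0 <= n%:R / 2 :> rat by rewrite divr_ge0 ?ler0n.
have count_le : \sum_(3 <= q < s.+1 | prime q) (t + 3)%:R / 2 <= (t + 3)%:R * s%:R / 4 :> rat.
  (* The prime 3 is split off, as the reindexing by odd numbers starts from an even bound. *)
  rewrite big_ltn_cond /=; last by lia.
  have c_ge0 (q : nat) : 0 <= (t + 3)%:R / 2 :> rat by rewrite divr_ge0 ?ler0n.
  have s4 : (2.*2 <= s.+1)%N by lia.
  have := @sum_primes_leq_odd (fun=> (t + 3)%:R / 2) 2 s isT s4 c_ge0.
  rewrite /= -(lerD2l ((t + 3)%:R / 2)) => /le_trans; apply.
  rewrite sumr_const_nat -mulrS -[leLHS]mulr_natr.
  apply: half_mul_leq; first by rewrite ler0n.
  by rewrite -natrM ler_nat; lia.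
exact: lerD (ler_wpM2l n2_ge0 F_le) count_le.
Qed.

(** The main terms, [n / 9] from the primorial and [0.821 n] from the sieve, stay below [0.932 n].
    As [15 t <= s] and [s ^ 2 <= n], the terms in [t * s] cost at most [n / 20]; the rest is linear
    in [s], and [s <= n / 256]. *)
Lemma exponent_bound_contra n s t :
    (2 ^ 16 <= n)%N -> (s ^ 2 <= n)%N -> (n < s.+1 ^ 2)%N -> (15 * t <= s)%N ->
    (n <= 2 ^ t)%N ->
  (t * (s./2 + 2) + 2 * (n %/ 18).+1 +
    \sum_(3 <= q < s.+1 | prime q) log_weight q * uphalf (n %/ q ^ 2) < n)%N.
Proof.
move=> n_ge le_sn lt_ns le_ts le_nt.
have s_ge := sqrt_ge_256 n_ge lt_ns.
rewrite -(ltr_nat rat) natrD.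
apply: le_lt_trans (lerD (lexx _) (sum_log_weight_leq n_ge le_sn lt_ns le_nt)) _.
rewrite !(natrD, natrM).
have h1 : 2 * (s./2)%:R <= s%:R :> rat by rewrite -natrM ler_nat; lia.
have h2 : 18 * (n %/ 18).+1%:R <= n%:R + 18 :> rat.
  by rewrite -natrM -natrD ler_nat; lia.
have h3 : s%:R * s%:R <= n%:R :> rat by rewrite -natrM ler_nat mulnn.
have h4 : 15 * t%:R <= s%:R :> rat by rewrite -natrM ler_nat.
have h5 : 256 <= s%:R :> rat by rewrite ler_nat.
have t_ge0 : 0 <= t%:R :> rat by [].
move: ((s./2)%:R : rat) ((n %/ 18).+1%:R : rat) (n%:R : rat) (s%:R : rat)
  (t%:R : rat) h1 h2 h3 h4 h5 t_ge0.
move=> h d x y z h1 h2 h3 h4 h5 t_ge0.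
have y_ge0 : 0 <= y by apply: le_trans h5; rewrite ler0n.
(* These products supply the quadratic facts that make the goal linear. *)
have := ler_wpM2l t_ge0 h1; have := ler_wpM2r y_ge0 h4; have := ler_wpM2r y_ge0 h5.
clear -h1 h2 h3 h4 h5; lra.
Qed.

End RationalBounds.

(** * Even numbers below 2^16 *)

Fixpoint add_progression (k : nat) (x d : positive) (T : PositiveSet.t) :=
  if k is k'.+1 then add_progression k' (Pos.add x d) d (PositiveSet.add x T)
  else T.

Lemma add_progression_sub k x d T y :
  PositiveSet.mem y T -> PositiveSet.mem y (add_progression k x d T).
Proof.
elim: k x T => [|k IHk] x T //= Ty; apply: IHk.
by apply/PositiveSet.add_spec; right.
Qed.

Lemma mem_add_progression k i x d T y :
    i < k -> Pos.to_nat y = Pos.to_nat x + i * Pos.to_nat d ->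
  PositiveSet.mem y (add_progression k x d T).
Proof.
elim: k i x T => // k IHk [|i] x T ltik yE /=; last first.
  by apply: (IHk i) => //; lia.
apply/add_progression_sub/PositiveSet.add_spec; left.
by apply: Pos2Nat.inj; lia.
Qed.

(** The number of terms comes from [(2i + 1) * q ^ 2 < 2 ^ 16], which forces
    [i <= 2 ^ 15 / q ^ 2]. *)
Definition odd_multiples (q : nat) : PositiveSet.t -> PositiveSet.t :=
  let d := Pos.of_nat (q ^ 2) in
  add_progression (N.to_nat (N.div 32768 (Npos d))).+1 d (Pos.add d d).

(** The primes run up to 255 because [q ^ 2 < 2 ^ 16]. An odd number below [2 ^ 16] that is absent
    from the table is square-free. *)
Definition non_square_free_table : PositiveSet.t :=
  foldr odd_multiples PositiveSet.empty [seq q <- iota 3 253 | prime q].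

Lemma non_square_free_tableP x q :
    0 < Pos.to_nat x < 2 ^ 16 -> odd (Pos.to_nat x) -> prime q ->
    q ^ 2 %| Pos.to_nat x ->
  PositiveSet.mem x non_square_free_table.
Proof.
move=> x_bounds odd_x q_pr q2x.
have odd_q : odd q by move: (dvdn_odd q2x odd_x); rewrite oddX.
have q_gt2 : 2 < q by apply: odd_prime_gt2.
have ltq : q < 256.
  rewrite -ltn_sqr; apply: leq_ltn_trans (dvdn_leq _ q2x) _; first by lia.
  by move: x_bounds; lia.
have: q \in [seq q <- iota 3 253 | prime q].
  by rewrite mem_filter q_pr mem_iota q_gt2.
rewrite /non_square_free_table; elim: [seq q <- _ | _] => //= r s IHs.
rewrite inE => /predU1P[<- | /IHs]; last exact: add_progression_sub.
have [e xE] := dvdnP q2x.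
have e_odd : odd e by move: odd_x; rewrite xE oddM => /andP[].
have q2_gt0 : 0 < q ^ 2 by lia.
apply: (@mem_add_progression _ e./2).
  suff : e./2 <= N.to_nat (N.div 32768 (Npos (Pos.of_nat (q ^ 2)))) by [].
  have := odd_double_half e; rewrite e_odd => eE.
  set Q := q ^ 2 in q2_gt0 xE *.
  have : N.le (N.of_nat e./2) (N.div 32768 (Npos (Pos.of_nat Q))); last by lia.
  apply: N.div_le_lower_bound; [by [] | nia].
rewrite Pos2Nat.inj_add Nat2Pos.id; last by lia.
by have := odd_double_half e; rewrite e_odd; nia.
Qed.

Definition small_odd_primes : seq nat := [:: 3; 5; 7; 11; 13; 17; 19; 23; 29; 31].

Definition good (T : PositiveSet.t) (ps : seq nat) (n : positive) : bool :=
  has (fun p => Pos.ltb (Pos.of_nat p) n &&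
    ~~ PositiveSet.mem (Pos.sub n (Pos.of_nat p)) T) ps.

Fixpoint all_good T ps (k : nat) (n : positive) : bool :=
  if k is k'.+1 then
    if good T ps n then all_good T ps k' (Pos.add n 2) else false
  else true.

Lemma all_goodP T ps k i n m :
    all_good T ps k n -> i < k -> Pos.to_nat m = Pos.to_nat n + i.*2 ->
  good T ps m.
Proof.
elim: k i n => //= k IHk i n; case: ifP => // good_n all_k.
case: i => [_ mE | i lt_ik mE]; last by apply: (IHk i) all_k _ _; lia.
suff -> : m = n by [].
by apply: Pos2Nat.inj; lia.
Qed.

(** The 32766 numbers tested are the even ones from 4 to 65534. *)
Lemma all_good_below :
  all_good non_square_free_table small_odd_primes
    (N.to_nat 32766) 4.
Proof. by vm_compute. Qed.

Lemma small_odd_primesP p : p \in small_odd_primes -> prime p && odd p.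
Proof. by apply/allP: p. Qed.

Lemma small_case n : ~~ odd n -> 3 < n < 2 ^ 16 ->
  exists p eta : nat,
    [/\ prime p, odd eta, square_free eta & n = p + eta].
Proof.
move=> n_even n_bounds.
have ltk : (n - 4)./2 < N.to_nat 32766 by move: n_bounds; lia.
have nE : Pos.to_nat (Pos.of_nat n) = Pos.to_nat 4 + (n - 4)./2.*2.
  by move: n_bounds n_even; lia.
have := all_goodP all_good_below ltk nE.
(* Generalising the table prevents its evaluation in what follows. *)
have := non_square_free_tableP; move: non_square_free_table => T TP.
rewrite /good => /hasP[p /small_odd_primesP/andP[p_pr p_odd] /andP[lt_pn free]].
have {}lt_pn : p < n by have := prime_gt0 p_pr; lia.
have odd_eta : odd (n - p) by rewrite oddB ?(ltnW lt_pn) // p_odd (negPf n_even).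
exists p, (n - p); split=> //; last by lia.
split=> [|q q_pr]; first by lia.
apply: contra free => q2n; have p_gt0 := prime_gt0 p_pr.
have xE : Pos.to_nat (Pos.sub (Pos.of_nat n) (Pos.of_nat p)) = n - p by lia.
apply: (TP _ q) => //; rewrite xE //.
by move: n_bounds; lia.
Qed.

(** * The theorem for all even numbers above 3 *)

Definition has_prime_square (m : nat) : bool :=
  has (fun q => prime q && (q ^ 2 %| m)) (iota 0 m.+1).

Lemma square_freeN m : 0 < m -> ~~ has_prime_square m -> square_free m.
Proof.
move=> m_gt0 /hasPn no_q; split=> // q q_pr; apply/negP => q2m.
have : q \in iota 0 m.+1.
  rewrite mem_iota ltnS; apply: leq_trans (dvdn_leq m_gt0 q2m).
  by rewrite -mulnn leq_pmulr ?prime_gt0.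
by move/no_q; rewrite q_pr q2m.
Qed.

Theorem theorem3 (n : nat) (n_even : ~~ odd n) (n_gt3 : 3 < n) :
  exists p eta : nat,
    [/\ prime p, odd eta, square_free eta & n = p + eta].
Proof.
have [n_small | n_ge] := ltnP n (2 ^ 16).
  by apply: small_case; rewrite // n_gt3.
have odd_sub p : prime p -> (n %/ 18).+2 <= p < n -> odd (n - p).
  move=> p_pr /andP[p_ge lt_pn]; rewrite oddB ?(ltnW lt_pn) // (negPf n_even) /=.
  by case: (even_prime p_pr) => // p2; lia.
(* A boolean search decides whether some [p] in the range leaves a square-free difference; if none
   does, every prime there is sieved out and the two exponent bounds contradict each other. *)
have [/hasP[p] | /hasPn sieve] :=
    boolP (has (fun p => prime p && ~~ has_prime_square (n - p))
             (index_iota (n %/ 18).+2 n)).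
  rewrite mem_index_iota => p_range /andP[p_pr free].
  have /andP[_ lt_pn] := p_range.
  exists p, (n - p); split; rewrite ?odd_sub ?subnKC ?(ltnW lt_pn) //.
  by apply: square_freeN free; rewrite subn_gt0.
pose s := PeanoNat.Nat.sqrt n; have [le_sn lt_ns] := PeanoNat.Nat.sqrt_spec' n.
have {}le_sn : s ^ 2 <= n by rewrite /s; lia.
have {}lt_ns : n < s.+1 ^ 2 by rewrite /s; lia.
have le_nt := up_logP n (isT : 1 < 2).
have le_ts := up_log2_leq n_ge lt_ns.
have := exponent_bound_contra n_ge le_sn lt_ns le_ts le_nt.
have s_ge := sqrt_ge_256 n_ge lt_ns; clear n_ge.
have s_ge3 : 3 <= s by lia.
have n_ge36 : 36 <= n by apply: leq_trans le_sn; rewrite (leq_sqr 6); lia.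
rewrite ltnNge sieve_exponent_bound //.
move=> p p_range p_pr.
have : p \in index_iota (n %/ 18).+2 n by rewrite mem_index_iota.
move/sieve; rewrite p_pr negbK => /hasP[q _ /andP[q_pr q2_np]].
exists q; split=> //; have := dvdn_odd q2_np (odd_sub p p_pr p_range).
by rewrite oddX.
Qed.
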